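(* Let $A$ be a ring, $\mathfrak a=(t)\subseteq A$ a principal ideal, $M$ an $\mathfrak a$-adically complete $A$-module, and $P$ a finite $A$-module such that $\mathfrak a^h\subseteq H_P$. Let $r$ and $n$ be natural numbers such that: (1) $\mathfrak a^rM\cap\mathrm{Ann}_M(t)=0$; (2) $n>\max(r+h,\,2h)$. Then for every homomorphism $\psi\colon P\to M/\mathfrak a^nM$ there exists a homomorphism $\psi'\colon P\to M$ such that the composite of $\psi'$ with the quotient map $M\to M/\mathfrak a^{n-h}M$ equals the composite of $\psi$ with the quotient map $M/\mathfrak a^nM\to M/\mathfrak a^{n-h}M$.
   Context: All rings are commutative, unital and Noetherian. Here $h$ is a natural number, homomorphisms are homomorphisms of $A$-modules, $\mathrm{Ann}_M(t)=\{m\in M: tm=0\}$, and for an $A$-module $P$ the ideal $H_P\subseteq A$ is $H_P=\bigcap_{M}\mathrm{Ann}_A(\mathrm{Ext}^1_A(P,M))$, the intersection over all $A$-modules $M$. *)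

(* Defs.v *)
From HB Require Import structures.
From mathcomp Require Import all_boot all_order all_algebra ring_quotient.
From mathcomp Require Import finmap boolp classical_sets functions cardinality fsbigop.

Set Implicit Arguments.
Unset Strict Implicit.
Unset Printing Implicit Defensive.

Import GRing.Theory.

Local Open Scope classical_set_scope.
Local Open Scope quotient_scope.
Local Open Scope ring_scope.

(* [submodClosed] does not record closure under opposites, which the quotient
   construction of ring_quotient requires.  *)
Section SubmodPred.
Variables (R : pzRingType) (V : lmodType R) (S : submodClosed V).

Definition submod_pred : pred V := fun x => x \in S.

Lemma submod_pred_closed : GRing.subsemimod_closed submod_pred.
Proof. by split; [split; [exact: rpred0|exact: rpredD]|move=> a; exact: rpredZ]. Qed.

HB.instance Definition _ :=
  GRing.isSubmodClosed.Build R V submod_pred submod_pred_closed.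

End SubmodPred.

Section Subobjects.
Variables (R : pzRingType) (V : lmodType R) (S : submodClosed V).

Definition lsub : Type := {x : V | submod_pred S x}.

HB.instance Definition _ := SubChoice.on lsub.

HB.instance Definition _ :=
  GRing.SubChoice_isSubLmodule.Build R V (submod_pred S) lsub (submod_pred_closed S).

Definition lquot : Type := Quotient.quot (GRing.ZmodClosed.clone V (submod_pred S) _).

HB.instance Definition _ := ZmodQuotient.on lquot.

Definition lpi (v : V) : lquot := \pi v.
Definition lrepr (x : lquot) : V := repr x.

Lemma lreprK : cancel lrepr lpi.
Proof. exact: reprK. Qed.

Lemma eq_lpi (u v : V) : (lpi u == lpi v) = (u - v \in S).
Proof. by rewrite /lpi -Quotient.idealrBE. Qed.

Lemma lpiB : {morph lpi : u v / u - v}.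
Proof. exact: pi_is_zmod_morphism. Qed.

HB.instance Definition _ := GRing.isZmodMorphism.Build V lquot lpi lpiB.

Definition lquot_scale (a : R) (x : lquot) : lquot := lpi (a *: lrepr x).

Lemma lquot_scale_pi a v : lquot_scale a (lpi v) = lpi (a *: v).
Proof.
by apply/eqP; rewrite eq_lpi -scalerBr; apply: rpredZ; rewrite -eq_lpi lreprK.
Qed.

Lemma lquot_scaleA a b x :
  lquot_scale a (lquot_scale b x) = lquot_scale (a * b) x.
Proof. by rewrite -(lreprK x) !lquot_scale_pi scalerA. Qed.

Lemma lquot_scale1 : left_id 1 lquot_scale.
Proof. by move=> x; rewrite -(lreprK x) lquot_scale_pi scale1r. Qed.

Lemma lquot_scaleDr : right_distributive lquot_scale +%R.
Proof.
move=> a x y; rewrite -(lreprK x) -(lreprK y) -raddfD !lquot_scale_pi.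
by rewrite scalerDr raddfD.
Qed.

Lemma lquot_scaleDl x : {morph lquot_scale^~ x : a b / a + b}.
Proof.
by move=> a b; rewrite -(lreprK x) !lquot_scale_pi scalerDl raddfD.
Qed.

HB.instance Definition _ := GRing.Zmodule_isLmodule.Build R lquot
  lquot_scaleA lquot_scale1 lquot_scaleDr lquot_scaleDl.

Lemma lpiZ : scalable lpi.
Proof. by move=> a v; rewrite -lquot_scale_pi. Qed.

HB.instance Definition _ := GRing.isScalable.Build R V lquot *:%R lpi lpiZ.

End Subobjects.

(* The map V/S -> V/T, meaningful when S is contained in T; see
   [lquot_map_lpi].  *)
Definition lquot_map (R : pzRingType) (V : lmodType R) (S T : submodClosed V)
  (x : lquot S) : lquot T := lpi T (lrepr x).

Lemma lquot_map_lpi (R : pzRingType) (V : lmodType R) (S T : submodClosed V) (v : V) :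
  {subset S <= T} -> lquot_map T (lpi S v) = lpi T v.
Proof.
by move=> sST; apply/eqP; rewrite eq_lpi; apply: sST; rewrite -eq_lpi lreprK.
Qed.

Section Kernel.
Variables (R : pzRingType) (U V : lmodType R) (f : {linear U -> V}).

Definition kerm : {pred U} := [pred u | f u == 0].

Lemma kerm_closed : GRing.subsemimod_closed kerm.
Proof.
split; [split|].
- by rewrite inE raddf0.
- by move=> u v /eqP fu /eqP fv; apply/eqP; rewrite linearD fu fv addr0.
- by move=> a u /eqP fu; apply/eqP; rewrite linearZ /= fu scaler0.
Qed.

HB.instance Definition _ := GRing.isSubmodClosed.Build R U kerm kerm_closed.

End Kernel.

(* Cohomology of U -f-> V -g-> W at V.  *)
Section Cohomology.
Variables (R : pzRingType) (U V W : lmodType R).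
Variables (f : {linear U -> V}) (g : {linear V -> W}).

Definition coboundary : {pred lsub (kerm g)} :=
  [pred z | `[< exists u, val z = f u >]].

Lemma coboundary_closed : GRing.subsemimod_closed coboundary.
Proof.
split; [split|].
- by apply/asboolP; exists 0; rewrite !raddf0.
- move=> x y /asboolP[u eu] /asboolP[v ev]; apply/asboolP; exists (u + v).
  by rewrite !raddfD /= eu ev.
- move=> a x /asboolP[u eu]; apply/asboolP; exists (a *: u).
  by rewrite !linearZ /= eu.
Qed.

HB.instance Definition _ :=
  GRing.isSubmodClosed.Build R _ coboundary coboundary_closed.

Definition cohomology : lmodType R := lquot coboundary.

End Cohomology.

Section Hom.
Variables (R : comPzRingType) (U V : lmodType R).

Definition is_linear : {pred U -> V} := [pred f | `[< linear f >]].

Arguments is_linear : clear implicits.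

Lemma is_linear_closed : GRing.subsemimod_closed is_linear.
Proof.
split; [split|].
- by apply/asboolP => a x y; rewrite scaler0 addr0.
- move=> f g /asboolP lf /asboolP lg; apply/asboolP => a x y /=.
  by rewrite !fctE lf lg scalerDr addrACA.
- move=> b f /asboolP lf; apply/asboolP => a x y.
  by rewrite !fctE lf scalerDr !scalerA mulrC.
Qed.

HB.instance Definition _ :=
  GRing.isSubmodClosed.Build R _ is_linear is_linear_closed.

Definition hom : lmodType R := lsub is_linear.

End Hom.

Arguments is_linear {R} U V.

Section Precomposition.
Variables (R : comPzRingType) (U V W : lmodType R) (d : {linear U -> V}).

Lemma precomp_subproof (f : hom V W) : val f \o d \in is_linear U W.
Proof.
by apply/asboolP => a x y /=; rewrite linearP; case: f => f /= /asboolP ->.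
Qed.

Definition precomp (f : hom V W) : hom U W := Sub (val f \o d) (precomp_subproof f).

Lemma precomp_linear : linear precomp.
Proof. by move=> a f g; apply: val_inj. Qed.

HB.instance Definition _ :=
  GRing.isLinear.Build R (hom V W) (hom U W) *:%R precomp precomp_linear.

End Precomposition.

Arguments precomp {R U V} W d f.

Section FreeModule.
Variables (R : pzRingType) (X : choiceType).

Definition is_finsupp : {pred X -> R^o} :=
  [pred f | `[< finite_set [set x | f x != 0] >]].

Lemma is_finsupp_closed : GRing.subsemimod_closed is_finsupp.
Proof.
split; [split|].
- by apply/asboolP; rewrite (_ : [set _ | _] = set0) // -subset0 => x /eqP.
- move=> f g /asboolP ff /asboolP fg; apply/asboolP.
  apply: (@sub_finite_set _ _ ([set x | f x != 0] `|` [set x | g x != 0])).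
    move=> x /=; rewrite fctE; case: (eqVneq (f x) 0) => [->|]; last by left.
    by rewrite add0r; right.
  by rewrite finite_setU.
- move=> a f /asboolP ff; apply/asboolP; apply: sub_finite_set ff => x /=.
  by apply: contra_neq; rewrite fctE => ->; rewrite scaler0.
Qed.

HB.instance Definition _ :=
  GRing.isSubmodClosed.Build R _ is_finsupp is_finsupp_closed.

Definition free_mod : lmodType R := lsub is_finsupp.

Variables (V : lmodType R) (g : X -> V).

Definition lin_ext (f : free_mod) : V := \sum_(x \in [set: X]) (val f x : R) *: g x.

Lemma lin_extE (f : free_mod) (D : {fset X}) :
  [set x | val f x != 0] `<=` [set` D] ->
  lin_ext f = \sum_(x <- D) (val f x : R) *: g x.
Proof.
move=> sD; apply: fsbigTE => x /negP xD; case: (eqVneq (val f x) 0) => [->|nz].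
  by rewrite scale0r.
by case: xD; exact: sD.
Qed.

Lemma lin_ext_linear : linear lin_ext.
Proof.
move=> a f1 f2.
have fin (f : free_mod) : finite_set [set x | val f x != 0].
  by case: f => f /= /asboolP.
have valE x : val (a *: f1 + f2) x = (a * val f1 x + val f2 x : R) by [].
pose D := fset_set ([set x | val f1 x != 0] `|` [set x | val f2 x != 0]).
have DE : [set` D] = [set x | val f1 x != 0] `|` [set x | val f2 x != 0].
  by rewrite /D fset_setK // finite_setU.
rewrite !(@lin_extE _ D) ?DE; last 3 first.
- by move=> x; right.
- by move=> x; left.
- move=> x nz; case: (eqVneq (val f1 x) 0) => [f10|]; last by left.
  case: (eqVneq (val f2 x) 0) => [f20|]; last by right.
  by case/eqP: nz; apply: etrans (valE x) _; rewrite f10 f20 mulr0 addr0.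
rewrite scaler_sumr -big_split /=; apply: eq_bigr => x _.
by rewrite scalerA -scalerDl.
Qed.

HB.instance Definition _ :=
  GRing.isLinear.Build R free_mod V *:%R lin_ext lin_ext_linear.

Lemma free_gen_subproof (x : X) :
  (fun y => (y == x)%:R : R^o) \in is_finsupp.
Proof.
apply/asboolP; apply: (@sub_finite_set _ _ [set x]) => // y /=.
by case: (eqVneq y x) => // _; rewrite eqxx.
Qed.

Definition free_gen (x : X) : free_mod :=
  Sub (fun y => (y == x)%:R : R^o) (free_gen_subproof x).

Lemma lin_ext_gen (x : X) : lin_ext (free_gen x) = g x.
Proof.
rewrite (@lin_extE _ [fset x]%fset) ?big_seq_fset1 /= ?eqxx ?scale1r // => y /=.
by case: (eqVneq y x) => [->|_]; rewrite ?inE // eqxx.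
Qed.

End FreeModule.

Lemma lin_ext_kerm (R : pzRingType) (U V : lmodType R) (f : {linear U -> V})
    (u : U) :
  f u = 0 <-> exists v, lin_ext (val : lsub (kerm f) -> U) v = u.
Proof.
split=> [fu|[v <-]].
  have ku : submod_pred (kerm f) u by apply/eqP.
  exists (free_gen R (Sub u ku : lsub (kerm f))).
  by rewrite lin_ext_gen.
rewrite /lin_ext raddf_sum big1 // => -[x /= kx] _.
by rewrite linearZ /= (eqP kx) scaler0.
Qed.

Definition ann_ideal (A : comPzRingType) (M : lmodType A) : set A :=
  [set a | forall m : M, a *: m = 0].

Definition ann_elt (A : comPzRingType) (M : lmodType A) (t : A) : set M :=
  [set m | t *: m = 0].

Arguments ann_elt {A} M t.

(* Start of the standard free resolution F2 -> F1 -> F0 -> P -> 0: F0 is free on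
   the underlying set of P and each further term is free on that of the
   preceding kernel. Ext1 P M is the degree 1 cohomology of Hom(F, M).  *)
Section Ext.
Variables (A : comPzRingType) (P : lmodType A).

Definition res0 : lmodType A := free_mod A P.
Definition res_aug : {linear res0 -> P} := lin_ext (@id P).
Definition res1 : lmodType A := free_mod A (lsub (kerm res_aug)).
Definition res_d1 : {linear res1 -> res0} :=
  lin_ext (val : lsub (kerm res_aug) -> res0).
Definition res2 : lmodType A := free_mod A (lsub (kerm res_d1)).
Definition res_d2 : {linear res2 -> res1} :=
  lin_ext (val : lsub (kerm res_d1) -> res1).

Lemma res_aug_surj (p : P) : exists u, res_aug u = p.
Proof. by exists (free_gen A p); apply: lin_ext_gen. Qed.

Lemma res_exact0 u : res_aug u = 0 <-> exists v, res_d1 v = u.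
Proof. exact: lin_ext_kerm. Qed.

Lemma res_exact1 u : res_d1 u = 0 <-> exists v, res_d2 v = u.
Proof. exact: lin_ext_kerm. Qed.

Definition Ext1 (M : lmodType A) : lmodType A :=
  cohomology (precomp M res_d1) (precomp M res_d2).

Definition H_ideal : set A :=
  [set a | forall M : lmodType A, ann_ideal (Ext1 M) a].

End Ext.

Definition finite_module (A : comPzRingType) (M : lmodType A) : Prop :=
  exists (k : nat) (g : 'I_k -> M),
    forall m, exists c : 'I_k -> A, m = \sum_(i < k) c i *: g i.

(* An ideal of A is a submodule of the regular module A^o.  *)
Definition noetherian (A : comPzRingType) : Prop :=
  forall I : submodClosed A^o, finite_module (lsub I).

Section Adic.
Variable A : comPzRingType.

Definition principal_ideal (t : A) : set A := [set a * t | a in [set: A]].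

(* The submodule I N of finite sums of products; for V the regular module it
   is the product of ideals.  *)
Definition smul (V : lmodType A) (I : set A) (N : set V) : set V :=
  [set v | exists (k : nat) (a : 'I_k -> A) (x : 'I_k -> V),
    [/\ forall i, I (a i), forall i, N (x i) & v = \sum_(i < k) a i *: x i]].

Fixpoint ideal_exp (I : set A) (n : nat) : set A :=
  if n is n'.+1 then smul (V := A^o) I (ideal_exp I n') else [set: A].

(* The submodule I^n V.  *)
Definition adic (I : set A) (n : nat) (V : lmodType A) : {pred V} :=
  [pred v | `[< smul (ideal_exp I n) [set: V] v >]].

Arguments adic I n V : clear implicits.

Lemma adic_closed I n V : GRing.subsemimod_closed (adic I n V).
Proof.
split; [split|].
- apply/asboolP; exists 0, (fun=> 0), (fun=> 0).
  by split; [case|case|rewrite big_ord0].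
- move=> u v /asboolP[k [a [x [Ia _ ->]]]] /asboolP[l [b [y [Ib _ ->]]]].
  apply/asboolP; exists (k + l)%N.
  exists (fun i => match fintype.split i with inl j => a j | inr j => b j end).
  exists (fun i => match fintype.split i with inl j => x j | inr j => y j end).
  split=> // [i|]; first by case: fintype.split.
  rewrite big_split_ord /=; congr (_ + _); apply: eq_bigr => i _.
    by rewrite (unsplitK (inl i)).
  by rewrite (unsplitK (inr i)).
- move=> c u /asboolP[k [a [x [Ia _ ->]]]]; apply/asboolP.
  exists k, a, (fun i => c *: x i); split=> //.
  by rewrite scaler_sumr; apply: eq_bigr => i _; rewrite !scalerA mulrC.
Qed.

HB.instance Definition _ I n V :=
  GRing.isSubmodClosed.Build A V (adic I n V) (adic_closed I n V).

Lemma adic_subset I n m V : (m <= n)%N -> {subset adic I n V <= adic I m V}.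
Proof.
move=> le_mn v /asboolP[k [a [x [Ia _ ->]]]]; apply/asboolP; exists k, a, x.
split=> // i; have {Ia} := Ia i; move: (a i) => {}a.
have [d ->] : exists d, n = (d + m)%N by exists (n - m)%N; rewrite subnK.
suff leS j b : ideal_exp I j.+1 b -> ideal_exp I j b.
  by elim: d => //= d IHd /leS /IHd.
elim: j b => [//|j IHj] b [l [c [y [Ic Iy ->]]]].
by exists l, c, y; split=> // i'; exact/IHj/Iy.
Qed.

Definition adic_quot (I : set A) (n : nat) (V : lmodType A) : lmodType A :=
  lquot (adic I n V).

(* The canonical map from V to the inverse limit of the V / I^n V is
   bijective; in particular V is separated.  *)
Definition adic_complete (I : set A) (V : lmodType A) : Prop :=
  forall x : forall n, adic_quot I n V,
    (forall n, lquot_map (adic I n V) (x n.+1) = x n) ->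
    exists! v : V, forall n, lpi (adic I n V) v = x n.

End Adic.

Arguments adic {A} I n V.

(* Main.v *)
(* Lift psi on the free cover F0 -> P to phi : F0 -> M. Then c = phi \o d1 is a
   1-cocycle with values in t^n M, so t^h c = u \o d1 with u : F0 -> t^n M. Write
   u = t^h u' with u' : F0 -> t^(n-h) M; as n - h >= r, multiplication by t^h is
   injective on t^(n-h) M, so u' is linear and c = u' \o d1. Hence phi - u'
   descends to P, and it agrees with phi modulo t^(n-h) M. *)
Require Import Defs.
From HB Require Import structures.
From mathcomp Require Import all_boot all_order all_algebra.
From mathcomp Require Import finmap boolp classical_sets cardinality.

Set Implicit Arguments.
Unset Strict Implicit.
Unset Printing Implicit Defensive.

Import GRing.Theory.

Local Open Scope classical_set_scope.
Local Open Scope ring_scope.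

Lemma linear_ex (A : pzRingType) (U V : lmodType A) (f : U -> V) :
  linear f -> exists g : {linear U -> V}, g =1 f.
Proof.
move=> lf; pose m := GRing.isLinear.Build A U V *:%R f lf.
by exists (HB.pack f m : {linear U -> V}).
Qed.

Lemma linear_corestrict (A : pzRingType) (U V : lmodType A) (S : submodClosed V)
    (f : {linear U -> V}) :
  (forall u, f u \in S) ->
  exists g : {linear U -> lsub S}, forall u, val (g u) = f u.
Proof.
move=> fS; pose g u : lsub S := Sub (f u) (fS u).
have lg : linear g by move=> a u v; apply: val_inj; rewrite /= linearP.
by have [g' g'E] := linear_ex lg; exists g' => u; rewrite g'E.
Qed.

(** A set-theoretic section [s] of [g] is enough: since [f] vanishes on the kernel of [g], [f u]
    depends only on [g u], so [f \o s] is linear although [s] need not be. *)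
Lemma linear_factor (A : pzRingType) (U V W : lmodType A)
    (g : {linear U -> V}) (f : {linear U -> W}) :
  (forall v, exists u, g u = v) -> (forall u, g u = 0 -> f u = 0) ->
  exists k : {linear V -> W}, forall u, k (g u) = f u.
Proof.
move=> /choice[s sK] gf.
have fE u v : g u = g v -> f u = f v.
  move=> guv; apply/eqP; rewrite -subr_eq0 -linearB; apply/eqP/gf.
  by rewrite linearB guv subrr.
have lk : linear (f \o s).
  by move=> a x y /=; rewrite -linearP; apply: fE; rewrite linearP !sK.
by have [k kE] := linear_ex lk; exists k => u; rewrite kE; apply: fE; rewrite sK.
Qed.

Lemma linear_lin_ext (A : pzRingType) (X : choiceType) (V W : lmodType A)
    (g : X -> V) (f : {linear V -> W}) (x : free_mod A X) :
  f (lin_ext g x) = lin_ext (f \o g) x.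
Proof.
have fin : finite_set [set y | val x y != 0] by case: x => x /= /asboolP.
rewrite !(@lin_extE _ _ _ _ _ (fset_set [set y | val x y != 0])) ?fset_setK //.
by rewrite raddf_sum; apply: eq_bigr => y _; rewrite -linearZ.
Qed.

(** The map [c] is a 1-cocycle of the resolution; [b] annihilates its class in [Ext1 P N], so
    [b *: c] is a coboundary. *)
Lemma H_ideal_cocycle (A : comPzRingType) (P N : lmodType A) (b : A)
    (c : {linear res1 P -> N}) :
  H_ideal P b -> (forall x, c (res_d2 P x) = 0) ->
  exists u : {linear res0 P -> N}, forall x, b *: c x = u (res_d1 P x).
Proof.
move=> bH cd2.
have cL : (c : _ -> _) \in is_linear (res1 P) N.
  by apply/asboolP; exact: linearP.
pose c1 : Defs.hom (res1 P) N := Sub (c : _ -> _) cL.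
have c1K : submod_pred (kerm (precomp N (res_d2 P))) c1.
  by apply/eqP/val_inj/funext => x; exact: cd2.
pose z : lsub (kerm (precomp N (res_d2 P))) := Sub c1 c1K.
have /eqP := bH N (lpi _ z : Ext1 P N).
(* Writing 0 as the class of 0 turns the vanishing of the class into membership in [coboundary]. *)
rewrite -linearZ -[0](raddf0 (lpi _)) eq_lpi subr0 => /asboolP[[u uL] zu].
have [v vE] := linear_ex (asboolW uL).
exists v => x; rewrite vE.
by have /(congr1 val)/(congr1 (@^~ x)) := zu.
Qed.

Lemma principal_idealP (A : comPzRingType) (t b : A) :
  principal_ideal t b <-> exists c, b = c * t.
Proof. by split=> [[c _ <-]|[c ->]]; exists c. Qed.

Lemma ideal_exp_principal (A : comPzRingType) (t : A) (n : nat) :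
  ideal_exp (principal_ideal t) n = principal_ideal (t ^+ n).
Proof.
elim: n => [|n IHn] /=.
  by apply/seteqP; split=> // b _; apply/principal_idealP; exists b; rewrite mulr1.
rewrite IHn; apply/seteqP; split=> b.
  move=> [k [x [y [xE yE ->]]]]; apply/principal_idealP.
  have /choice[p pE] i := (principal_idealP t (x i)).1 (xE i).
  have /choice[q qE] i := (principal_idealP (t ^+ n) (y i)).1 (yE i).
  exists (\sum_(i < k) p i * q i); rewrite mulr_suml; apply: eq_bigr => i _.
  by rewrite pE qE exprS mulrACA.
move=> /principal_idealP[c ->].
exists 1%N, (fun=> t), (fun=> c * t ^+ n); split=> [_|_|].
- by apply/principal_idealP; exists 1; rewrite mul1r.
- by apply/principal_idealP; exists c.
- by rewrite big_ord1 exprS mulrCA.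
Qed.

(** All coefficients of a finite sum in I^n V share the factor t^n, which can be pulled out. *)
Lemma adic_principal (A : comPzRingType) (t : A) (n : nat) (V : lmodType A) (v : V) :
  (v \in adic (principal_ideal t) n V) <-> exists w, v = t ^+ n *: w.
Proof.
split=> [/asboolP[k [a [x []]]]|[w ->]].
  rewrite ideal_exp_principal => aE _ ->.
  have /choice[p pE] i := (principal_idealP (t ^+ n) (a i)).1 (aE i).
  exists (\sum_(i < k) p i *: x i); rewrite scaler_sumr; apply: eq_bigr => i _.
  by rewrite pE scalerA mulrC.
apply/asboolP; exists 1%N, (fun=> t ^+ n), (fun=> w); split=> //.
  by move=> _; rewrite ideal_exp_principal; exists 1; rewrite // mul1r.
by rewrite big_ord1.
Qed.

(** Powers of [t] are cancelled one at a time: [t ^+ h *: m] stays in I^r M, so if [t] kills it, it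
    is already 0. *)
Lemma exp_regular_adic (A : comPzRingType) (t : A) (M : lmodType A) (r h : nat) :
  [set` adic (principal_ideal t) r M] `&` ann_elt M t = [set 0] ->
  {in adic (principal_ideal t) r M, forall m, t ^+ h *: m = 0 -> m = 0}.
Proof.
move=> tors; elim: h => [|h IHh] m rm; first by rewrite expr0 scale1r.
rewrite exprS -scalerA => tm; apply: (IHh) => //.
suff : [set 0] (t ^+ h *: m) by [].
by rewrite -tors; split=> //; exact: (rpredZ (t ^+ h) rm).
Qed.

Theorem theorem25 (A : comPzRingType) (A_noeth : noetherian A)
    (t : A) (a : set A) (a_def : a = principal_ideal t)
    (M : lmodType A) (M_complete : adic_complete a M)
    (P : lmodType A) (P_finite : finite_module P)
    (h : nat) (a_H : ideal_exp a h `<=` H_ideal P)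
    (r n : nat)
    (M_tors : [set` adic a r M] `&` ann_elt M t = [set 0])
    (n_gt : (maxn (r + h) (2 * h) < n)%N)
    (psi : {linear P -> adic_quot a n M}) :
  exists psi' : {linear P -> M},
    lpi (adic a (n - h) M) \o psi' =1 lquot_map (adic a (n - h) M) \o psi.
Proof.
subst a; set I := principal_ideal t in M_complete a_H M_tors psi *.
have rhn : (r + h < n)%N by apply: leq_ltn_trans n_gt; apply: leq_maxl.
have hn : (h <= n)%N by apply: leq_trans (ltnW rhn); apply: leq_addl.
have rnh : (r <= n - h)%N by rewrite leq_subRL // addnC ltnW.
have reg m : m \in adic I (n - h) M -> t ^+ h *: m = 0 -> m = 0.
  by move=> /(adic_subset rnh); exact: exp_regular_adic.
(* Arbitrary representatives of the values of [psi] will do, because F0 is free on the underlying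
   set of P. *)
pose phi : {linear res0 P -> M} := lin_ext (fun p => lrepr (psi p)).
have phiE x : lpi (adic I n M) (phi x) = psi (res_aug P x).
  rewrite !linear_lin_ext; congr (lin_ext _ x).
  by apply/funext => p /=; rewrite lreprK.
have cn x : (phi \o res_d1 P) x \in adic I n M.
  rewrite -[_ x]subr0 -eq_lpi raddf0 /= phiE.
  by rewrite (res_exact0 _).2 ?raddf0 //; exists x.
(* The cocycle is taken with coefficients in I^n M rather than M, so that the cochain [u] bounding
   its multiple also has values in I^n M. *)
have [c cE] := linear_corestrict cn.
have tH : H_ideal P (t ^+ h).
  by apply: a_H; rewrite ideal_exp_principal; exists 1; rewrite // mul1r.
have cd2 x : c (res_d2 P x) = 0.
  apply: val_inj; rewrite cE /= (res_exact1 _).2 ?raddf0 //.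
  by exists x.
have [u uE] := H_ideal_cocycle tH cd2.
have /choice[u' u'E] x : exists m, m \in adic I (n - h) M /\ t ^+ h *: m = val (u x).
  have [w wE] := (adic_principal t n (val (u x))).1 (valP (u x)).
  exists (t ^+ (n - h) *: w); split; first by apply/adic_principal; exists w.
  by rewrite scalerA -exprD subnKC.
(* The values of [u'] were chosen pointwise; its defect of linearity lies in I^(n-h) M and is killed
   by t^h, because [u] is linear. *)
have u'_lin : linear u'.
  move=> b x y; apply/eqP; rewrite -subr_eq0; apply/eqP/reg.
    by rewrite rpredB ?rpredD ?rpredZ ?(u'E _).1.
  rewrite scalerBr scalerDr !scalerA mulrC -scalerA !(u'E _).2 linearP.
  exact: subrr.
have [v vE] := linear_ex u'_lin.
(* For x = d1 y both terms lie in I^(n-h) M, and t^h times their difference is t^h c(y) - u(d1 y) =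
   0. *)
have kill x : res_aug P x = 0 -> (phi \- v) x = 0.
  move=> /res_exact0[y <-]; apply: reg => /=.
    rewrite vE rpredB ?(u'E _).1 //.
    by apply: adic_subset (cn y); exact: leq_subr.
  rewrite vE scalerBr (u'E _).2 -uE -(cE y : _ = phi (res_d1 P y)); exact: subrr.
have [psi' psi'E] := linear_factor (@res_aug_surj _ P) kill.
exists psi' => p /=; have [x <-] := res_aug_surj p.
rewrite psi'E -phiE lquot_map_lpi; last exact: adic_subset (leq_subr h n).
by apply/eqP; rewrite eq_lpi /= vE addrAC subrr add0r rpredN (u'E _).1.
Qed.
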